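(* (a) Every slice of $\mathcal{S}_+^3$ of dimension at most $4$ admits a $\mathcal{Q}^2$-lift. (b) If a $5$-dimensional slice $S$ of $\mathcal{S}_+^3$ is second-order cone representable (socr), then $S$ is the image of $\mathcal{Q}^2$ under a linear map.
   Context: $\mathcal{S}^k$ denotes the vector space of real symmetric $k \times k$ matrices and $\mathcal{S}_+^k \subseteq \mathcal{S}^k$ the cone of symmetric positive semidefinite matrices. For a real vector space $V$ and a convex cone $C \subseteq V$, a set $S \subseteq C$ is a slice of $C$ if $S$ is the intersection of $C$ and a linear subspace of $V$. The dimension of a slice is the dimension of its linear hull. A set $S$ has (admits) a $C$-lift if $S$ is the image of a slice of $C$ under a linear map. Let $\mathcal{Q} := \{x \in \mathbb{R}^3 : x_3 \ge \sqrt{x_1^2 + x_2^2}\}$ be the three-dimensional Lorentz cone and $\mathcal{Q}^m := \mathcal{Q} \times \cdots \times \mathcal{Q}$ ($m$ factors), a convex cone in $(\mathbb{R}^3)^m$. A closed convex cone is second-order cone representable (socr) if it has a $\mathcal{Q}^m$-lift for some positive integer $m$. *)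

(* Defs.v *)
From mathcomp Require Import all_boot all_order all_algebra.
From mathcomp Require Import boolp classical_sets reals.

Set Implicit Arguments.
Unset Strict Implicit.
Unset Printing Implicit Defensive.

Import Order.TTheory GRing.Theory Num.Theory.

Local Open Scope classical_set_scope.
Local Open Scope ring_scope.

Definition slice (R : realType) (V : vectType R) (C S : set V) : Prop :=
  exists L : {vspace V}, S = C `&` [set x | x \in L].

(* [U] is the smallest subspace containing [S]. *)
Definition is_linear_hull (R : realType) (V : vectType R) (S : set V)
    (U : {vspace V}) : Prop :=
  (forall x, S x -> x \in U) /\
  (forall W : {vspace V}, (forall x, S x -> x \in W) -> (U <= W)%VS).

(* The default value is never reached, see [linear_hullP]. *)
Definition linear_hull (R : realType) (V : vectType R) (S : set V) :
    {vspace V} :=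
  xget 0%VS [set U | is_linear_hull S U].

Lemma linear_hullP (R : realType) (V : vectType R) (S : set V) :
  is_linear_hull S (linear_hull S).
Proof.
apply: (@xgetPex _ 0%VS [set U | is_linear_hull S U]).
pose P n := `[< exists W : {vspace V}, \dim W = n /\ forall x, S x -> x \in W >].
have exP : exists n, P n.
  by exists (\dim {:V}); apply/asboolP; exists fullv; split=> // x _; rewrite memvf.
case: (ex_minnP exP) => n /asboolP [U [dU SU]] minU.
exists U; split=> // W SW; apply/capv_idPl/eqP.
rewrite eqEdim capvSl /= dU; apply: minU; apply/asboolP.
by exists (U :&: W)%VS; split=> // x Sx; rewrite memv_cap SU ?SW.
Qed.

Definition set_dim (R : realType) (V : vectType R) (S : set V) : nat :=
  \dim (linear_hull S).

Definition has_lift (R : realType) (V W : vectType R) (C : set V) (S : set W) :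
    Prop :=
  exists2 T : set V, slice C T & exists f : {linear V -> W}, S = f @` T.

Definition symv (R : realType) (k : nat) : {vspace 'M[R]_k} :=
  fixedSpace (linfun (@trmx R k k)).

Lemma symvP (R : realType) (k : nat) (A : 'M[R]_k) :
  reflect (A^T = A) (A \in symv R k).
Proof. by apply: (iffP fixedSpaceP); rewrite lfunE. Qed.

Notation "''Sym[' R ]_ k" := (subvs_of (symv R k))
  (at level 8, k at level 2, format "''Sym[' R ]_ k") : type_scope.

Definition psd_cone (R : realType) (k : nat) : set 'Sym[R]_k :=
  [set A | forall x : 'cV[R]_k, 0 <= (x^T *m vsval A *m x) 0 0].

(* The coordinates x_1, x_2, x_3 are the entries of index 0, 1, 2. *)
Definition lorentz (R : realType) : set 'rV[R]_3 :=
  [set x | Num.sqrt (x 0 0 ^+ 2 + x 0 1 ^+ 2) <= x 0 2%:R].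

Definition lorentz_pow (R : realType) (m : nat) :
    set {ffun 'I_m -> 'rV[R]_3} :=
  [set x | forall i, lorentz (x i)].

(* The notion is meant for closed convex cones [S]; this is not required here
   because slices of [psd_cone] are automatically closed convex cones. *)
Definition socr (R : realType) (W : vectType R) (S : set W) : Prop :=
  exists2 m : nat, (0 < m)%N & has_lift (@lorentz_pow R m) S.

Arguments psd_cone : clear implicits.
Arguments lorentz : clear implicits.
Arguments lorentz_pow : clear implicits.

(* Main.v *)
Require Import Defs.
From HB Require Import structures.
From mathcomp Require Import all_boot all_order all_algebra.
From mathcomp Require Import boolp classical_sets cardinality reals.
From mathcomp Require Import polyrcf ring lra zify.

Set Implicit Arguments.
Unset Strict Implicit.
Unset Printing Implicit Defensive.

Import Order.TTheory GRing.Theory Num.Theory.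

Local Open Scope classical_set_scope.
Local Open Scope ring_scope.

(** Let S be a slice of the cone of positive semidefinite 3 x 3 matrices and L its
    linear hull. A linear form vanishing on L is A |-> tr(A B) for a symmetric B.
    Only the congruence type of B matters, as replacing A by Q A Q^T preserves
    the cone. Up to sign there are two cases ([symmetric_form_dichotomy]).

    - B is semidefinite. As B is a sum of matrices w w^T, tr(A B) = 0 forces
      A w = 0 for all A in S, for some nonzero w ([psd_orthogonal]).
    - B is indefinite. Then B has two isotropic vectors that are not orthogonal
      to each other, and B is congruent to the matrix of 2 x_0 x_2 + c x_1^2;
      the determinant of B is a nonzero multiple of c.

    In the first case, and in the second one when c = 0, a congruence makes S a
    slice of the cone of positive semidefinite N with N_02 = 0. Such an N is a
    sum of two positive semidefinite matrices, supported on the index pairs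
    {0,1} and {1,2} ([psd_tridiagonal]); positive semidefinite 2 x 2 matrices
    form a copy of the Lorentz cone, so this cone is a linear image of two
    Lorentz cones ([tridiag_lift_image]).

    This is enough for (a): when L has dimension at most 4, the symmetric B
    orthogonal to L form a space of dimension at least 2, on a pencil of which
    the determinant is a cubic form; it has a real zero, so B can be taken
    singular, and c = 0 in the indefinite case.

    For (b), B is unique up to a factor and L is the whole hyperplane
    tr(A B) = 0, which rules out the first case ([kernel_codim]). If c = 0, then S
    is the full linear image above. It remains to see that S has no lift when
    c is nonzero. Then x^T B x = 0 is a nondegenerate conic with infinitely many
    points v_n, no three of them collinear, and the v_n v_n^T lie in S. For two of
    them, v_s and v_t, the vector w orthogonal to both gives a linear form
    A |-> w^T A w that is nonnegative on S and vanishes at v_s v_s^T and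
    v_t v_t^T, but at no other v_u v_u^T. No infinite family with this property
    exists in a cone with a Lorentz lift ([no_lorentz_lift]): let x_n in Q^m lie
    above the n-th point. The coordinate of index i of x_n spans a ray of Q,
    and on an infinite set of n these rays are all the same or pairwise
    distinct. In the first case x_u is on the ray of x_s; in the second one
    x_s + x_t is in the interior of Q, since Q is strictly convex. Either way some
    multiple of x_s + x_t dominates x_u in the order of Q. Doing this for every
    factor, a multiple of x_s + x_t dominates x_u in Q^m, and a nonnegative linear
    form that vanishes at s and t vanishes at u. *)

(** * Sums and statements over three indices *)

Lemma sum_ord3 (V : zmodType) (F : 'I_3 -> V) : \sum_i F i = F 0 + F 1 + F 2%:R.
Proof.
rewrite !big_ord_recl big_ord0 addr0 addrA.
by congr (F _ + F _ + F _); apply: val_inj.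
Qed.

Lemma forall_ord3 (P : 'I_3 -> Prop) : P 0 -> P 1 -> P 2%:R -> forall i, P i.
Proof.
move=> P0 P1 P2 [[|[|[|i]]] Hi] //.
- by rewrite (_ : Ordinal Hi = 0) //; apply: val_inj.
- by rewrite (_ : Ordinal Hi = 1) //; apply: val_inj.
- by rewrite (_ : Ordinal Hi = 2%:R) //; apply: val_inj.
Qed.

(** * The order of the Lorentz cone *)

Lemma lorentzE (R : realType) (x : 'rV[R]_3) :
  lorentz R x <-> 0 <= x 0 2%:R /\ x 0 0 ^+ 2 + x 0 1 ^+ 2 <= x 0 2%:R ^+ 2.
Proof.
rewrite /lorentz /=; split=> [le_x|[x2 le_x]].
  have x2 : 0 <= x 0 2%:R := le_trans (sqrtr_ge0 _) le_x.
  split=> //; rewrite -(@ler_sqrt _ _ (x 0 2%:R ^+ 2)) ?sqr_ge0 //.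
  by rewrite sqrtr_sqr ger0_norm.
by rewrite -(ger0_norm x2) -sqrtr_sqr ler_wsqrtr.
Qed.

Lemma lorentzD (R : realType) (x y : 'rV[R]_3) :
  lorentz R x -> lorentz R y -> lorentz R (x + y).
Proof.
move=> /lorentzE[x2 qx] /lorentzE[y2 qy]; apply/lorentzE; rewrite !mxE.
move: (x 0 0) (x 0 1) (x 0 _) (y 0 0) (y 0 1) (y 0 _) x2 qx y2 qy
  => a b c d e f c0 qx f0 qy; split; first exact: addr_ge0.
suff : a * d + b * e <= c * f by nra.
rewrite (le_trans (ler_norm _)) // -(@ler_pXn2r _ 2) ?nnegrE ?mulr_ge0 //.
rewrite real_normK ?num_real // exprMn.
have cs : (a * d + b * e) ^+ 2 <= (a ^+ 2 + b ^+ 2) * (d ^+ 2 + e ^+ 2).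
  by have := sqr_ge0 (a * e - b * d); nra.
apply: le_trans cs _; apply: ler_pM => //; exact: addr_ge0 (sqr_ge0 _) (sqr_ge0 _).
Qed.

Lemma lorentzZ (R : realType) (k : R) (x : 'rV[R]_3) :
  0 <= k -> lorentz R x -> lorentz R (k *: x).
Proof.
move=> k0 /lorentzE[x2 qx]; apply/lorentzE; rewrite !mxE.
split; first exact: mulr_ge0.
by rewrite !exprMn -mulrDr ler_wpM2l ?sqr_ge0.
Qed.

Lemma lorentz_eq0 (R : realType) (x : 'rV[R]_3) :
  lorentz R x -> x 0 2%:R = 0 -> x = 0.
Proof.
move=> /lorentzE[_ qx] x2; rewrite x2 expr0n /= in qx.
have /eqP : x 0 0 ^+ 2 + x 0 1 ^+ 2 = 0.
  by apply/eqP; rewrite eq_le qx addr_ge0 ?sqr_ge0.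
rewrite paddr_eq0 ?sqr_ge0 // !sqrf_eq0 => /andP[/eqP x0 /eqP x1].
by apply/rowP; apply: forall_ord3; rewrite !mxE.
Qed.

(** Interior points of a cone are order units: for large K the quadratic form at
    K z - y is dominated by its K^2 term. *)
Lemma lorentz_order_unit (R : realType) (z y : 'rV[R]_3) :
  0 < z 0 2%:R -> z 0 0 ^+ 2 + z 0 1 ^+ 2 < z 0 2%:R ^+ 2 -> lorentz R y ->
  exists2 K, 0 <= K & lorentz R (K *: z - y).
Proof.
move=> z2 qz /lorentzE[y2 qy].
pose q := z 0 2%:R ^+ 2 - (z 0 0 ^+ 2 + z 0 1 ^+ 2).
pose b := z 0 2%:R * y 0 2%:R - (z 0 0 * y 0 0 + z 0 1 * y 0 1).
have q0 : 0 < q by rewrite subr_gt0.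
pose k1 := 2%:R * `|b| / q; pose k2 := y 0 2%:R / z 0 2%:R.
have k10 : 0 <= k1 by rewrite divr_ge0 ?mulr_ge0 // ltW.
have k20 : 0 <= k2 by rewrite divr_ge0 // ltW.
have k1q : k1 * q = 2%:R * `|b| by rewrite divfK ?gt_eqF.
have k2z : k2 * z 0 2%:R = y 0 2%:R by rewrite divfK ?gt_eqF.
exists (k1 + k2); first exact: addr_ge0.
apply/lorentzE; rewrite !mxE mulrDl k2z addrK.
split; first by rewrite mulr_ge0 // ltW.
rewrite -[in leRHS]k2z in qy *; rewrite -subr_ge0.
have bb := ler_norm b.
suff : 0 <= (k1 + k2) * ((k1 + k2) * q - 2%:R * b) +
   (y 0 2%:R ^+ 2 - (y 0 0 ^+ 2 + y 0 1 ^+ 2)).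
  rewrite /q /b -k2z; lra.
apply: addr_ge0; last by rewrite subr_ge0 -k2z.
apply: mulr_ge0; first exact: addr_ge0.
rewrite mulrDl k1q; have : 0 <= k2 * q by rewrite mulr_ge0 // ltW.
lra.
Qed.

(** * Neighborly families obstruct Lorentz lifts *)

(** Either some fibre of [c] is infinite, or all fibres are finite and choosing one
    point in each gives an infinite set. *)
Lemma infinite_const_or_inj (U : Type) (c : nat -> U) (A : set nat) :
  infinite_set A -> exists2 B, B `<=` A & infinite_set B /\
    ((forall s t, B s -> B t -> c s = c t) \/
     (forall s t, B s -> B t -> c s = c t -> s = t)).
Proof.
move=> Ainf.
have [[y yinf]|fin] := pselect (exists y, infinite_set (A `&` [set t | c t = y])).
  exists (A `&` [set t | c t = y]); first exact: subIsetl.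
  by split=> //; left=> s t [_ /= ->] [_ /= ->].
pose r y := xget 0 (A `&` [set t | c t = y]).
have rP t : A t -> A (r (c t)) /\ c (r (c t)) = c t.
  by move=> At; apply: (xgetPex 0 (P := A `&` [set t' | c t' = c t])); exists t.
exists (A `&` [set t | t = r (c t)]); first exact: subIsetl.
split; last by right=> s t [_ /= es] [_ /= et] e; rewrite es e -et.
move=> Bfin; apply: Ainf.
(* With finite fibres over a finite image, [A] would be finite. *)
pose D := c @` (A `&` [set t | t = r (c t)]).
apply: (@sub_finite_set _ _ (\bigcup_(y in D) (A `&` [set t | c t = y]))).
  move=> t At; have [Ar cr] := rP t At.
  by exists (c t); [exists (r (c t)); rewrite //= cr | ].
apply: bigcup_finite; first exact: finite_image.
by move=> y _; apply: contrapT => yinf; apply: fin; exists y.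
Qed.

(** Equivalently, [y] lies in the face of the Lorentz cone generated by [a]. *)
Definition dominated (R : realType) (a y : 'rV[R]_3) :=
  exists2 K, 0 <= K & lorentz R (K *: a - y).

(** Two distinct points of the unit disc have their weighted means in the open
    disc; here the points are the sections of the rays of [x] and [y] at height 1. *)
Lemma lorentz_strictly_convex (R : realType) (x y : 'rV[R]_3) :
  lorentz R x -> lorentz R y -> 0 < x 0 2%:R -> 0 < y 0 2%:R ->
  (x 0 2%:R)^-1 *: x <> (y 0 2%:R)^-1 *: y ->
  (x + y) 0 0 ^+ 2 + (x + y) 0 1 ^+ 2 < (x + y) 0 2%:R ^+ 2.
Proof.
move=> /lorentzE[_ qx] /lorentzE[_ qy] x2 y2 neq.
pose d i := y 0 2%:R * x 0 i - x 0 2%:R * y 0 i.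
have dpos : 0 < d 0 ^+ 2 + d 1 ^+ 2.
  rewrite lt_neqAle addr_ge0 ?sqr_ge0 // andbT eq_sym; apply/negP.
  rewrite paddr_eq0 ?sqr_ge0 // !sqrf_eq0 !subr_eq0 => /andP[/eqP d0 /eqP d1].
  apply: neq; apply/rowP => i; rewrite !mxE; move: i.
  have eqi i : y 0 2%:R * x 0 i = x 0 2%:R * y 0 i ->
      (x 0 2%:R)^-1 * x 0 i = (y 0 2%:R)^-1 * y 0 i.
    move=> e; apply: (mulfI (lt0r_neq0 x2)); apply: (mulfI (lt0r_neq0 y2)).
    by rewrite (mulVKf (lt0r_neq0 x2)) e mulrCA (mulVKf (lt0r_neq0 y2)).
  by apply: forall_ord3; apply: eqi => //; rewrite mulrC.
rewrite !mxE; move: dpos; rewrite /d {d neq}.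
move: (x 0 0) (x 0 1) (x 0 _) (y 0 0) (y 0 1) (y 0 _) x2 qx y2 qy
  => a b c d e f c0 qx f0 qy dpos.
suff : a * d + b * e < c * f by nra.
(* The squared distance [dpos] of the rescaled points is at most twice this. *)
suff : 0 < c * f * (c * f - (a * d + b * e)).
  by rewrite pmulr_rgt0 ?mulr_gt0 // subr_gt0.
have h1 : f ^+ 2 * (a ^+ 2 + b ^+ 2) <= f ^+ 2 * c ^+ 2.
  by rewrite ler_wpM2l ?sqr_ge0.
have h2 : c ^+ 2 * (d ^+ 2 + e ^+ 2) <= c ^+ 2 * f ^+ 2.
  by rewrite ler_wpM2l ?sqr_ge0.
lra.
Qed.

(** The colour of [n] is the ray of [x n], given by its point at height 1. If the
    colour is constant, [x u] is a multiple of [x s]; if it is injective,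
    [x s + x t] is interior. *)
Lemma infinite_subset_dominated (R : realType) (x : nat -> 'rV[R]_3)
    (A : set nat) :
  (forall n, lorentz R (x n)) -> infinite_set A ->
  exists2 B, B `<=` A & infinite_set B /\
    forall s t u, B s -> B t -> B u -> s <> t -> dominated (x s + x t) (x u).
Proof.
move=> xQ Ainf; pose c n := (x n 0 2%:R)^-1 *: x n.
have [B BA [Binf]] := infinite_const_or_inj c Ainf.
have x2 n : 0 <= x n 0 2%:R by have /lorentzE[] := xQ n.
have xE n : x n = x n 0 2%:R *: c n.
  rewrite /c scalerA; have [x0|x0] := eqVneq (x n 0 2%:R) 0.
    by rewrite {1}(lorentz_eq0 (xQ n) x0) x0 mul0r scale0r.
  by rewrite mulfV ?scale1r.
case=> [cst|inj].
  exists B => //; split=> // s t u Bs Bt Bu st.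
  have [xs0|xs0] := eqVneq (x s 0 2%:R) 0.
    exists 0 => //; rewrite (xE u) (cst u s Bu Bs) /c xs0 invr0 !scale0r scaler0.
    by rewrite subr0 -(scale0r (x s)); apply: lorentzZ.
  have [k k0 ->] : exists2 k, 0 <= k & x u = k *: x s.
    exists (x u 0 2%:R / x s 0 2%:R); first exact: divr_ge0.
    by rewrite {1}(xE u) (cst u s Bu Bs) /c scalerA.
  by exists k => //; rewrite scalerDr addrAC subrr add0r; apply: lorentzZ.
(* The inverse of 0 being 0, the zero vector has colour 0; as [c] is injective on
   [B], at most one index [z] has to be removed. *)
pose z := xget 0%N [set n | B n /\ x n = 0].
exists (B `\ z); first by move=> n [/BA].
have x2_gt0 n : (B `\ z) n -> 0 < x n 0 2%:R.
  move=> [Bn nz]; rewrite lt_neqAle eq_sym x2 andbT; apply/eqP => xn0.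
  have xn : x n = 0 := lorentz_eq0 (xQ n) xn0.
  have [Bz xz] : B z /\ x z = 0.
    by apply: (xgetPex 0%N (P := [set n | B n /\ x n = 0])); exists n.
  by apply: nz; apply: inj => //; rewrite /c xn xz !scaler0.
split=> [|s t u Bs Bt _ st]; first exact: infinite_setD.
apply: lorentz_order_unit; last exact: xQ.
  by rewrite mxE addr_gt0 ?x2_gt0.
apply: lorentz_strictly_convex; rewrite ?x2_gt0 //.
by move=> /(inj _ _ Bs.1 Bt.1).
Qed.

(** The factors are treated one after the other, each one inside the infinite set
    found for the previous ones. *)
Lemma infinite_subset_dominated_pow (R : realType) (m : nat)
    (x : nat -> {ffun 'I_m -> 'rV[R]_3}) :
  (forall n, lorentz_pow R m (x n)) ->
  exists2 B, infinite_set B & forall s t u, B s -> B t -> B u -> s <> t ->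
    exists K, lorentz_pow R m (K *: (x s + x t) - x u).
Proof.
move=> xQ.
have [B Binf dom] : exists2 B, infinite_set B & forall i, i \in enum 'I_m ->
    forall s t u, B s -> B t -> B u -> s <> t -> dominated (x s i + x t i) (x u i).
  elim: (enum 'I_m) => [|i r [A Ainf dom]]; first by exists setT => //; exact: infinite_nat.
  have [B BA [Binf domi]] := infinite_subset_dominated (fun n => xQ n i) Ainf.
  exists B => // j; rewrite inE => /predU1P[-> //|jr] s t u Bs Bt Bu.
  by apply: (dom j jr); apply: BA.
exists B => // s t u Bs Bt Bu st.
have /choice[K KP] (i : 'I_m) : exists K, 0 <= K /\
    lorentz R (K *: (x s i + x t i) - x u i).
  by have [|K K0 KQ] := dom i _ s t u Bs Bt Bu st; [rewrite mem_enum|exists K].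
exists (\sum_i K i) => i; rewrite !ffunE (bigD1 i) //= scalerDl addrAC.
apply: lorentzD; first by have [] := KP i.
apply: lorentzZ; last exact: lorentzD (xQ s i) (xQ t i).
by apply: sumr_ge0 => j _; have [] := KP j.
Qed.

(** The points [h n] are such that any two of them are cut out by a supporting
    hyperplane that misses all the others. A lift would give [s], [t], [u] with
    K (h s + h t) - h u in [S], where [f s t] takes the value - [f s t (h u)]. *)
Lemma no_lorentz_lift (R : realType) (m : nat) (W : vectType R) (S : set W)
    (h : nat -> W) (f : nat -> nat -> {linear W -> R^o}) :
  (forall n, S (h n)) -> (forall s t y, S y -> 0 <= f s t y) ->
  (forall s t, f s t (h s) = 0) -> (forall s t, f s t (h t) = 0) ->
  (forall s t u, s <> t -> u <> s -> u <> t -> f s t (h u) != 0) ->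
  ~ has_lift (lorentz_pow R m) S.
Proof.
move=> Sh f_ge0 fs ft fu [T [L TE] [p SE]].
have /choice[x xP] n : exists x, T x /\ p x = h n.
  by have := Sh n; rewrite SE => -[x Tx <-]; exists x.
have xQ n : lorentz_pow R m (x n).
  by have [+ _] := xP n; rewrite TE => -[].
have xL n : x n \in L.
  by have [+ _] := xP n; rewrite TE => -[].
have [B Binf dom] := infinite_subset_dominated_pow xQ.
have [s Bs] : B !=set0 by apply: infinite_setN0.
have [t [Bt /= ts]] : B `\ s !=set0.
  by apply: infinite_setN0; apply: infinite_setD.
have [u [[Bu us] ut]] : B `\ s `\ t !=set0.
  apply: infinite_setN0; apply: infinite_setD (finite_set1 _).
  exact: infinite_setD (finite_set1 _).
have st : s <> t by move=> e; apply: ts.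
have [K KQ] := dom s t u Bs Bt Bu st.
have : S (p (K *: (x s + x t) - x u)).
  rewrite SE; exists (K *: (x s + x t) - x u) => //; rewrite TE; split=> //=.
  by rewrite rpredB ?rpredZ ?rpredD.
move=> /(f_ge0 s t).
have xE n : p (x n) = h n by have [] := xP n.
rewrite !linearB !linearZ !linearD /= !xE fs ft addr0 scaler0 sub0r oppr_ge0 => fu0.
have /eqP := fu s t u st us ut; apply; apply/eqP; rewrite eq_le fu0 /=.
exact: f_ge0.
Qed.

(** * Positive semidefinite matrices *)

Section Forms.
Variables (R : realType) (n : nat).
Implicit Types (A B : 'M[R]_n) (x y z : 'cV[R]_n).

Definition bil A x y : R := (x^T *m A *m y) 0 0.
Definition psd A := A^T = A /\ forall x, 0 <= bil A x x.

Lemma bilC A x y : A^T = A -> bil A x y = bil A y x.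
Proof.
move=> As; rewrite /bil -[in RHS]As -[in RHS](trmxK x) -!trmx_mul mulmxA.
by rewrite [in RHS]mxE.
Qed.

Lemma bilDl A x y z : bil A (x + y) z = bil A x z + bil A y z.
Proof. by rewrite /bil linearD !mulmxDl mxE. Qed.

Lemma bilDr A x y z : bil A z (x + y) = bil A z x + bil A z y.
Proof. by rewrite /bil mulmxDr mxE. Qed.

Lemma bilZl A k x y : bil A (k *: x) y = k * bil A x y.
Proof. by rewrite /bil linearZ -!scalemxAl mxE. Qed.

Lemma bilZr A k x y : bil A y (k *: x) = k * bil A y x.
Proof. by rewrite /bil -scalemxAr mxE. Qed.

Lemma bil_sqrD A x y k : A^T = A ->
  bil A (x + k *: y) (x + k *: y) =
  bil A x x + 2%:R * k * bil A x y + k ^+ 2 * bil A y y.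
Proof.
by move=> As; rewrite !(bilDl, bilDr, bilZl, bilZr) (bilC y x As); ring.
Qed.

Lemma bil_delta A i j : bil A (delta_mx i 0) (delta_mx j 0) = A i j.
Proof. by rewrite /bil trmx_delta -rowE -colE !mxE. Qed.

(** If bil y x were nonzero, bil (y + t x) (y + t x) would be a nonconstant affine
    function of t. *)
Lemma psd_kernel A x : psd A -> bil A x x = 0 -> A *m x = 0.
Proof.
move=> [As A0] Ax.
suff b0 y : bil A y x = 0.
  apply/colP => i; have := b0 (delta_mx i 0).
  by rewrite /bil -mulmxA trmx_delta -rowE !mxE.
apply/eqP/negPn/negP => nz.
have := A0 (y + (- (bil A y y + 1) / (2%:R * bil A y x)) *: x).
rewrite bil_sqrD // Ax mulr0 addr0.
have -> : 2%:R * (- (bil A y y + 1) / (2%:R * bil A y x)) * bil A y x =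
  - (bil A y y + 1) by field.
by rewrite opprD addrA subrr sub0r leNgt oppr_lt0 ltr01.
Qed.

Lemma psd_cauchy_schwarz A x y : psd A ->
  bil A x y ^+ 2 <= bil A x x * bil A y y.
Proof.
move=> pA; have [As A0] := pA.
have [y0|y0] := eqVneq (bil A y y) 0.
  by rewrite y0 mulr0 /bil -mulmxA (psd_kernel pA y0) mulmx0 mxE expr0n.
have ypos : 0 < bil A y y by rewrite lt_neqAle eq_sym y0 A0.
have := A0 (x + (- (bil A x y / bil A y y)) *: y); rewrite bil_sqrD // => Axy.
rewrite -subr_ge0; have -> : bil A x x * bil A y y - bil A x y ^+ 2 =
  (bil A x x + 2%:R * - (bil A x y / bil A y y) * bil A x y +
   (- (bil A x y / bil A y y)) ^+ 2 * bil A y y) * bil A y y by field.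
by rewrite mulr_ge0.
Qed.

(** Cholesky elimination: for B_ii > 0, subtracting the rank one matrix that has the
    same row [i] as [B] leaves a positive semidefinite matrix with one more
    vanishing diagonal entry. *)
Lemma psd_sum_rank1 B : psd B ->
  exists r : seq 'cV[R]_n, B = \sum_(w <- r) w *m w^T.
Proof.
have [k] := ubnP #|[set i | B i i != 0]|%SET; elim: k B => // k IHk B /ltnSE cB pB.
have [Bs B0] := pB.
have [[i Bi]|Bd] := pselect (exists i, B i i != 0); last first.
  exists [::]; rewrite big_nil; apply/matrixP => i j.
  have Bj : bil B (delta_mx j 0) (delta_mx j 0) = 0.
    rewrite bil_delta; apply/eqP/negPn/negP => Bj; apply: Bd; by exists j.
  by have /colP/(_ i) := psd_kernel pB Bj; rewrite -colE !mxE.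
have Bi0 : 0 < B i i.
  by rewrite lt_neqAle eq_sym Bi -bil_delta B0.
pose w := (Num.sqrt (B i i))^-1 *: col i B.
have wwE : w *m w^T = (B i i)^-1 *: (col i B *m (col i B)^T).
  rewrite /w linearZ /= -scalemxAl -scalemxAr scalerA -invfM -expr2.
  by rewrite sqr_sqrtr // ltW.
have bE x : bil (B - w *m w^T) x x =
    bil B x x - (B i i)^-1 * bil B x (delta_mx i 0) ^+ 2.
  rewrite /bil mulmxBr mulmxBl mxE [X in _ + X]mxE; congr (_ - _).
  rewrite wwE -scalemxAr -scalemxAl mxE; congr (_ * _).
  rewrite [x^T *m (_ *m _)]mulmxA -[_ *m _ *m x]mulmxA mxE big_ord1 expr2.
  congr (_ * _).
    by rewrite -mulmxA colE.
  rewrite -[(col i B)^T *m x]trmxK trmx_mul trmxK mxE.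
  by rewrite -mulmxA colE.
have pB' : psd (B - w *m w^T).
  split; first by rewrite linearB /= trmx_mul trmxK Bs.
  move=> x; rewrite bE subr_ge0 mulrC ler_pdivrMr //.
  by rewrite -(bil_delta B i i); exact: psd_cauchy_schwarz.
have [r rE] : exists r : seq 'cV[R]_n, B - w *m w^T = \sum_(w <- r) w *m w^T.
  apply: IHk pB'; apply: leq_trans cB; apply: proper_card; apply/properP; split.
    apply/fintype.subsetP => j; rewrite !inE; apply: contraNneq => Bj.
    rewrite -bil_delta bE bil_delta Bj sub0r oppr_eq0 mulf_eq0 sqrf_eq0.
    rewrite bilC // /bil -mulmxA (psd_kernel pB) ?bil_delta //.
    by rewrite mulmx0 mxE eqxx orbT.
  exists i; rewrite inE ?Bi //.
  by rewrite -bil_delta bE !bil_delta expr2 mulKf // subrr eqxx.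
by exists (w :: r); rewrite big_cons -rE addrC subrK.
Qed.

Lemma mxtrace_rank1 A w : \tr (A *m (w *m w^T)) = bil A w w.
Proof. by rewrite mulmxA mxtrace_mulC mulmxA /mxtrace big_ord1. Qed.

(** Writing [B] as a sum of w w^T, the trace is the sum of the nonnegative numbers
    w^T A w, so all of them vanish; any nonzero w works as v. *)
Lemma psd_orthogonal B : psd B -> B != 0 ->
  exists2 v : 'cV[R]_n, v != 0 &
    forall A, psd A -> \tr (A *m B) = 0 -> A *m v = 0.
Proof.
move=> /psd_sum_rank1[r ->] r0.
have [v vr v0] : exists2 v, v \in r & v != 0.
  have [/hasP[v]|/hasPn h] := boolP (has (fun v => v != 0) r); first by exists v.
  case/eqP: r0; rewrite big_seq big1 // => w /h /negPn/eqP ->.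
  by rewrite mul0mx.
exists v => // A pA; rewrite mulmx_sumr raddf_sum /= => /eqP.
rewrite psumr_eq0 => [|w _]; last by rewrite mxtrace_rank1; case: pA.
move=> /allP /(_ v vr) /=; rewrite mxtrace_rank1 => /eqP.
exact: psd_kernel.
Qed.

End Forms.

Lemma mulmx_rank1 (R : realType) (n : nat) (x y : 'cV[R]_n) :
  x *m x^T *m y = bil 1%:M x y *: x.
Proof.
rewrite /bil mulmx1 -mulmxA [x^T *m y]mx11_scalar.
by rewrite mul_mx_scalar !mxE eqxx mulr1n.
Qed.

(** * Symmetric 3 x 3 matrices up to congruence *)

(** Indexing by natural numbers lets entries reduce by computation, whatever form
    the ordinals have. *)
Definition mx3 (R : realType) (f : nat -> nat -> R) : 'M[R]_3 := \matrix_(i, j) f i j.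

Lemma mx3E (R : realType) (A : 'M[R]_3) : A = mx3 (fun i j => A (inord i) (inord j)).
Proof. by apply/matrixP => i j; rewrite mxE !inord_val. Qed.

Lemma inord3 : (inord 0 : 'I_3) = 0 /\ (inord 1 : 'I_3) = 1 /\ (inord 2 : 'I_3) = 2%:R.
Proof. by split; [|split]; apply: val_inj; rewrite /= inordK. Qed.

Lemma det3 (R : realType) (A : 'M[R]_3) : \det A =
  A 0 0 * (A 1 1 * A 2%:R 2%:R - A 1 2%:R * A 2%:R 1)
  - A 0 1 * (A 1 0 * A 2%:R 2%:R - A 1 2%:R * A 2%:R 0)
  + A 0 2%:R * (A 1 0 * A 2%:R 1 - A 1 1 * A 2%:R 0).
Proof.
rewrite {1}[A]mx3E (expand_det_row _ 0) sum_ord3 /cofactor.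
rewrite !(expand_det_row _ (0 : 'I_2)) !big_ord_recl !big_ord0 /cofactor !det_mx11.
rewrite !mxE /= /bump /=.
have [-> [-> ->]] := inord3.
rewrite /= !(expr0, expr1, addr0); ring.
Qed.

Lemma tr3 (R : realType) (A : 'M[R]_3) : \tr A = A 0 0 + A 1 1 + A 2%:R 2%:R.
Proof. exact: sum_ord3. Qed.

Lemma bil3 (R : realType) (A : 'M[R]_3) (x y : 'cV[R]_3) : bil A x y =
  x 0 0 * (A 0 0 * y 0 0 + A 0 1 * y 1 0 + A 0 2%:R * y 2%:R 0)
  + x 1 0 * (A 1 0 * y 0 0 + A 1 1 * y 1 0 + A 1 2%:R * y 2%:R 0)
  + x 2%:R 0 * (A 2%:R 0 * y 0 0 + A 2%:R 1 * y 1 0 + A 2%:R 2%:R * y 2%:R 0).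
Proof. by rewrite /bil mxE sum_ord3 !mxE !sum_ord3 !mxE; ring. Qed.

Definition cross (R : realType) (u v : 'cV[R]_3) : 'cV[R]_3 :=
  \col_i nth 0 [:: u 1 0 * v 2%:R 0 - u 2%:R 0 * v 1 0;
                   u 2%:R 0 * v 0 0 - u 0 0 * v 2%:R 0;
                   u 0 0 * v 1 0 - u 1 0 * v 0 0] i.

(** The matrix of the quadratic form 2 x_0 x_2 + c x_1^2. *)
Definition hyperbolic_mx (R : realType) (c : R) : 'M[R]_3 :=
  mx3 (fun i j => if (i + j == 2)%N then (if i == 1%N then c else 1) else 0).

(** On the plane spanned by [x] and [y] the form is indefinite, so it has two
    independent zeros [e] and [h], and this plane is hyperbolic; the third basis vector [g] is taken
    orthogonal to this plane for [B]. *)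
Lemma indefinite_congruence (R : realType) (B : 'M[R]_3) (x y : 'cV[R]_3) :
  B^T = B -> 0 < bil B x x -> bil B y y < 0 ->
  exists2 P, P \in unitmx & exists c, P^T *m B *m P = hyperbolic_mx c.
Proof.
move=> Bs xpos yneg.
(* e and h are x + t y for the two roots t of a t^2 + 2 m t + bil B x x. *)
have [e [h [ee hh eh]]] : exists e h, [/\ bil B e e = 0, bil B h h = 0 & bil B e h = 1].
  pose a := bil B y y; pose m := bil B x y; pose d := m ^+ 2 - a * bil B x x.
  have d0 : 0 < d by rewrite /d /a; nra.
  pose s := Num.sqrt d.
  have ss : s ^+ 2 = d by rewrite sqr_sqrtr // ltW.
  have a0 : a != 0 by rewrite lt_eqF.
  pose e := x + ((- m + s) / a) *: y; pose h := x + ((- m - s) / a) *: y.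
  have ee : bil B e e = (s ^+ 2 - d) / a.
    by rewrite /e bil_sqrD // -/m -/a /d; field.
  have hh : bil B h h = (s ^+ 2 - d) / a.
    by rewrite /h bil_sqrD // -/m -/a /d; field.
  have eh : bil B e h = - (d + s ^+ 2) / a.
    by rewrite /e /h !(bilDl, bilDr, bilZl, bilZr) (bilC y x Bs) -/m -/a /d; field.
  have k0 : bil B e h != 0.
    rewrite eh ss mulf_neq0 ?invr_neq0 // oppr_eq0; apply: lt0r_neq0.
    exact: addr_gt0.
  exists e, ((bil B e h)^-1 *: h).
  rewrite !(bilZl, bilZr) hh ee ss subrr mul0r !mulr0; split=> //.
  by rewrite mulVf.
pose g := cross (B *m e) (B *m h).
pose P : 'M[R]_3 := \matrix_(i, j) nth 0 [:: e i 0; g i 0; h i 0] j.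
have colP0 : col 0 P = e by apply/colP => i; rewrite !mxE.
have colP1 : col 1 P = g by apply/colP => i; rewrite !mxE.
have colP2 : col 2%:R P = h by apply/colP => i; rewrite !mxE.
have PBP i j : (P^T *m B *m P) i j = bil B (col i P) (col j P).
  by rewrite -bil_delta /bil !colE trmx_mul !mulmxA.
have eB z : bil B e z = bil 1%:M (B *m e) z.
  by rewrite /bil mulmx1 trmx_mul Bs.
have hB z : bil B h z = bil 1%:M (B *m h) z.
  by rewrite /bil mulmx1 trmx_mul Bs.
have eg : bil B e g = 0.
  by rewrite eB bil3 !mxE /=; ring.
have hg : bil B h g = 0.
  by rewrite hB bil3 !mxE /=; ring.
exists P.
  rewrite unitmxE unitfE.
  suff -> : \det P = bil B e h ^+ 2 - bil B e e * bil B h h.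
    by rewrite eh ee mul0r subr0 expr1n oner_neq0.
  (* Binet-Cauchy identity for (B e x B h) . (h x e). *)
  rewrite expr2 {1}(bilC e h Bs) !eB !hB /P /g.
  move: (B *m e) (B *m h) => p q.
  rewrite det3 !bil3 !mxE /=; ring.
exists (bil B g g); apply/matrixP.
by do 2 (apply: forall_ord3 => /=); rewrite PBP ?colP0 ?colP1 ?colP2 mxE //=
  ?(bilC g e Bs) ?(bilC g h Bs) ?(bilC h e Bs).
Qed.

Lemma hyperbolic_det (R : realType) (c : R) : \det (hyperbolic_mx c) = - c.
Proof. by rewrite det3 !mxE /=; ring. Qed.

(** A form that is indefinite is brought to its hyperbolic normal form; the other
    ones are semidefinite up to sign. *)
Lemma symmetric_form_dichotomy (R : realType) (B : 'M[R]_3) : B^T = B -> B != 0 ->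
  (exists2 v : 'cV[R]_3, v != 0 &
     forall A, psd A -> \tr (A *m B) = 0 -> A *m v = 0) \/
  (exists2 Q, Q \in unitmx & exists c, B = Q^T *m hyperbolic_mx c *m Q).
Proof.
move=> Bs B0.
have [Bpos|/existsNP[y /negP]] := pselect (forall x, 0 <= bil B x x).
  by left; apply: psd_orthogonal.
rewrite -ltNge => yneg.
have [Bneg|/existsNP[x /negP]] := pselect (forall x, bil B x x <= 0).
  left; have [||v v0 vP] := @psd_orthogonal _ _ (- B).
  - split=> [|x]; first by rewrite linearN /= Bs.
    by rewrite /bil mulmxN mulNmx mxE oppr_ge0; apply: Bneg.
  - by rewrite oppr_eq0.
  by exists v => // A pA trA; apply: vP => //; rewrite mulmxN linearN /= trA oppr0.
rewrite -ltNge => xpos; right.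
have [P Pu [c PBP]] := indefinite_congruence Bs xpos yneg.
exists (invmx P); first by rewrite unitmx_inv.
exists c; rewrite -PBP !mulmxA -trmx_mul mulmxV // trmx1 mul1mx.
by rewrite -mulmxA mulmxV // mulmx1.
Qed.

Lemma mxtrace_hyperbolic (R : realType) (Q A : 'M[R]_3) (c : R) : A^T = A ->
  \tr (A *m (Q^T *m hyperbolic_mx c *m Q)) =
  2%:R * (Q *m A *m Q^T) 0 2%:R + c * (Q *m A *m Q^T) 1 1.
Proof.
move=> As; rewrite mulmxA mxtrace_mulC !mulmxA.
have : (Q *m A *m Q^T)^T = Q *m A *m Q^T by rewrite !trmx_mul trmxK As mulmxA.
move: (Q *m A *m Q^T) => N Ns.
have N20 : N 2%:R 0 = N 0 2%:R by rewrite -{1}Ns mxE.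
by rewrite tr3 !mxE !sum_ord3 !mxE /= N20; ring.
Qed.

(** * Two Lorentz cones cover the tridiagonal matrices *)

Lemma psd_congr (R : realType) (n : nat) (P A : 'M[R]_n) :
  psd A -> psd (P *m A *m P^T).
Proof.
move=> [As A0]; split; first by rewrite !trmx_mul trmxK As mulmxA.
by move=> x; have := A0 (P^T *m x); rewrite /bil trmx_mul trmxK !mulmxA.
Qed.

Lemma psd_coneP (R : realType) (n : nat) (A : 'Sym[R]_n) :
  psd_cone R n A <-> psd (vsval A).
Proof.
split=> [A0|[]//]; split=> //; exact/symvP/subvsP.
Qed.

(** The sum of two 2 x 2 blocks that overlap at the middle entry, each one being
    a vector of the Lorentz cone seen as a symmetric 2 x 2 matrix. *)
Definition tridiag (R : realType) (x : {ffun 'I_2 -> 'rV[R]_3}) : 'M[R]_3 :=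
  let a := x 0 in let b := x 1 in
  mx3 (fun i j => nth 0 (nth [::]
    [:: [:: a 0 2%:R + a 0 0; a 0 1; 0];
        [:: a 0 1; (a 0 2%:R - a 0 0) + (b 0 2%:R + b 0 0); b 0 1];
        [:: 0; b 0 1; b 0 2%:R - b 0 0]] i) j).

Lemma tridiag_is_linear (R : realType) : linear (@tridiag R).
Proof.
move=> k x y; apply/matrixP.
by do 2 (apply: forall_ord3 => /=); rewrite !mxE /= ?(ffunE, mxE); ring.
Qed.

HB.instance Definition _ (R : realType) :=
  GRing.isLinear.Build R _ _ _ (@tridiag R) (@tridiag_is_linear R).

(** At (- b, a) the form takes the value a (a c - b^2). *)
Lemma binary_form_lorentz (R : realType) (a b c : R) :
  (forall s t, 0 <= a * s ^+ 2 + 2%:R * b * s * t + c * t ^+ 2) ->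
  [/\ 0 <= a, 0 <= c & b ^+ 2 <= a * c].
Proof.
move=> pos.
have a0 : 0 <= a by have := pos 1 0; lra.
have c0 : 0 <= c by have := pos 0 1; lra.
split=> //; have [a00|apos] := eqVneq a 0.
  rewrite a00 mul0r in pos *.
  have [->|b0] := eqVneq b 0; first by rewrite expr0n.
  have := pos (- (c + 1) / (2%:R * b)) 1.
  have -> : 0 * (- (c + 1) / (2%:R * b)) ^+ 2 +
    2%:R * b * (- (c + 1) / (2%:R * b)) * 1 + c * 1 ^+ 2 = -1 by field.
  by rewrite ler0N1.
have := pos (- b) a.
have -> : a * (- b) ^+ 2 + 2%:R * b * - b * a + c * a ^+ 2 =
  a * (a * c - b ^+ 2) by ring.
by rewrite pmulr_rge0 ?subr_ge0 // lt_neqAle eq_sym apos.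
Qed.

(** The middle diagonal entry splits as N_11 = q + (N_11 - q) with q = N_01^2 / N_00,
    the least value that makes the first block positive semidefinite; the second
    block is then a Schur complement of [N]. *)
Lemma psd_tridiagonal (R : realType) (N : 'M[R]_3) :
  psd N -> N 0 2%:R = 0 -> exists2 x, lorentz_pow R 2 x & N = tridiag x.
Proof.
move=> [Ns N0] N02.
have sym i j : N i j = N j i by rewrite -[in LHS]Ns mxE.
pose q := N 0 1 ^+ 2 / N 0 0.
have bilN (s t u : R) : let x := \col_i nth 0 [:: s; t; u] i in
    bil N x x = N 0 0 * s ^+ 2 + 2%:R * N 0 1 * s * t + N 1 1 * t ^+ 2
      + 2%:R * N 1 2%:R * t * u + N 2%:R 2%:R * u ^+ 2.
  by move=> x; rewrite bil3 !mxE /= (sym 2%:R 0) (sym 2%:R 1) (sym 1 0) N02; ring.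
have [a0 _ N01] : [/\ 0 <= N 0 0, 0 <= N 1 1 & N 0 1 ^+ 2 <= N 0 0 * N 1 1].
  apply: binary_form_lorentz => s t.
  have := N0 (\col_i nth 0 [:: s; t; 0] i); rewrite bilN.
  by rewrite mulr0 expr0n mulr0 !addr0.
(* If N_00 = 0 then N_01 = 0, and q = 0 by the convention on division. *)
have qE : N 0 0 * q = N 0 1 ^+ 2.
  rewrite /q; have [a00|a00] := eqVneq (N 0 0) 0; last by field.
  move: N01; rewrite a00 !mul0r => N01; apply/esym/eqP.
  by rewrite eq_le N01 sqr_ge0.
have [e0 c0 N12] : [/\ 0 <= N 1 1 - q, 0 <= N 2%:R 2%:R &
    N 1 2%:R ^+ 2 <= (N 1 1 - q) * N 2%:R 2%:R].
  apply: binary_form_lorentz => t u.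
  (* The first coordinate minimizes the form for given t and u. *)
  have := N0 (\col_i nth 0 [:: - (N 0 1 * t / N 0 0); t; u] i); rewrite bilN.
  rewrite /q in qE *; have [a00|a00] := eqVneq (N 0 0) 0.
    rewrite a00 invr0 !mulr0 in qE *; have /eqP := esym qE.
    rewrite sqrf_eq0 => /eqP ->; lra.
  congr (0 <= _); by field.
pose vec (a b c : R) : 'rV[R]_3 := \row_i nth 0 [:: (a - c) / 2%:R; b; (a + c) / 2%:R] i.
have vecQ a b c : 0 <= a -> 0 <= c -> b ^+ 2 <= a * c -> lorentz R (vec a b c).
  move=> age cge bac; apply/lorentzE; rewrite !mxE /=; split; first lra.
  suff : 0 <= ((a + c) / 2%:R) ^+ 2 - (((a - c) / 2%:R) ^+ 2 + b ^+ 2) by rewrite subr_ge0.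
  have -> : ((a + c) / 2%:R) ^+ 2 - (((a - c) / 2%:R) ^+ 2 + b ^+ 2) = a * c - b ^+ 2 by field.
  by rewrite subr_ge0.
exists [ffun i => if i == 0 then vec (N 0 0) (N 0 1) q
                  else vec (N 1 1 - q) (N 1 2%:R) (N 2%:R 2%:R)].
  move=> i; rewrite ffunE; case: ifP => _; apply: vecQ => //.
    by rewrite /q divr_ge0 ?sqr_ge0.
  by rewrite qE.
apply/matrixP; do 2 (apply: forall_ord3 => /=); rewrite !mxE /= ?ffunE /= ?mxE /=
  ?(sym 2%:R 0) ?(sym 2%:R 1) ?(sym 1 0) ?N02 //; by field.
Qed.

Lemma tridiag_psd (R : realType) (x : {ffun 'I_2 -> 'rV[R]_3}) :
  lorentz_pow R 2 x -> psd (tridiag x).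
Proof.
move=> xQ; split.
  by apply/matrixP; do 2 (apply: forall_ord3 => /=); rewrite !mxE.
move=> y.
have form (z : 'rV[R]_3) s t : lorentz R z -> 0 <= (z 0 2%:R + z 0 0) * s ^+ 2 +
    2%:R * z 0 1 * s * t + (z 0 2%:R - z 0 0) * t ^+ 2.
  move=> /lorentzE[]; move: (z 0 0) (z 0 1) (z 0 _) => a b c c0 qz.
  have [cE|cN] := eqVneq c 0.
    have [-> ->] : a = 0 /\ b = 0 by split; nra.
    by rewrite cE; lra.
  have cpos : 0 < 2%:R * c by rewrite mulr_gt0 // lt_neqAle eq_sym cN.
  rewrite -(pmulr_rge0 _ cpos).
  have -> : 2%:R * c * ((c + a) * s ^+ 2 + 2%:R * b * s * t + (c - a) * t ^+ 2) =
    ((c + a) * s + b * t) ^+ 2 + ((c - a) * t + b * s) ^+ 2 +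
    (c ^+ 2 - (a ^+ 2 + b ^+ 2)) * (s ^+ 2 + t ^+ 2) by ring.
  by rewrite !addr_ge0 ?sqr_ge0 // mulr_ge0 ?subr_ge0 // addr_ge0 ?sqr_ge0.
have := addr_ge0 (form _ (y 0 0) (y 1 0) (xQ 0)) (form _ (y 1 0) (y 2%:R 0) (xQ 1)).
congr (0 <= _); rewrite bil3 !mxE /=; ring.
Qed.

(** The congruence undoes the change of basis [Q] after which the matrices of the
    slice have a vanishing (0, 2) entry. *)
Definition tridiag_lift (R : realType) (Q : 'M[R]_3)
    (x : {ffun 'I_2 -> 'rV[R]_3}) : 'Sym[R]_3 :=
  vsproj (symv R 3) (invmx Q *m tridiag x *m (invmx Q)^T).

Lemma tridiag_lift_is_linear (R : realType) (Q : 'M[R]_3) :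
  linear (tridiag_lift Q).
Proof.
move=> k x y; rewrite /tridiag_lift linearP mulmxDr -scalemxAr mulmxDl.
by rewrite -scalemxAl linearP.
Qed.

HB.instance Definition _ (R : realType) (Q : 'M[R]_3) :=
  GRing.isLinear.Build R _ _ _ (tridiag_lift Q) (tridiag_lift_is_linear Q).

Lemma tridiag_lift_image (R : realType) (Q : 'M[R]_3) : Q \in unitmx ->
  tridiag_lift Q @` lorentz_pow R 2 =
  [set A | psd_cone R 3 A /\ (Q *m vsval A *m Q^T) 0 2%:R = 0].
Proof.
move=> Qu; apply/seteqP; split=> [_ [x xQ <-]|A [/psd_coneP pA A02]] /=.
  have pT := psd_congr (invmx Q) (tridiag_psd xQ).
  have liftE : vsval (tridiag_lift Q x) = invmx Q *m tridiag x *m (invmx Q)^T.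
    by apply: vsprojK; apply/symvP; case: pT.
  split; first by apply/psd_coneP; rewrite liftE.
  rewrite liftE !mulmxA mulmxV // mul1mx -mulmxA -trmx_mul mulmxV // trmx1 mulmx1.
  by rewrite mxE.
have [x xQ xE] := psd_tridiagonal (psd_congr Q pA) A02.
exists x => //; apply: val_inj; rewrite /tridiag_lift -xE !mulmxA mulVmx // mul1mx.
by rewrite -mulmxA -trmx_mul mulVmx // trmx1 mulmx1 /= vsvalK.
Qed.

(** A slice of a linear image of a cone lifts to a slice of this cone, cut out by
    the preimage of the subspace. *)
Lemma slice_tridiag_lift (R : realType) (Q : 'M[R]_3) (S : set 'Sym[R]_3) :
  Q \in unitmx -> slice (psd_cone R 3) S ->
  (forall A, S A -> (Q *m vsval A *m Q^T) 0 2%:R = 0) ->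
  has_lift (lorentz_pow R 2) S.
Proof.
move=> Qu [L SE] S02; pose F := (linfun (tridiag_lift Q) @^-1: L)%VS.
have FE x : (x \in F) = (tridiag_lift Q x \in L) by rewrite -memv_preim lfunE.
exists (lorentz_pow R 2 `&` [set x | x \in F]); first by exists F.
exists (tridiag_lift Q); apply/seteqP; split=> [A SA|_ [x [xQ /= xF] <-]].
  have := S02 A SA; move: SA; rewrite SE => -[pA /= AL] A02.
  have : (tridiag_lift Q @` lorentz_pow R 2) A by rewrite tridiag_lift_image.
  by move=> [x xQ xA]; exists x => //; split=> //=; rewrite FE xA.
rewrite SE; split; last by rewrite /= -FE.
have : (tridiag_lift Q @` lorentz_pow R 2) (tridiag_lift Q x) by exists x.
by rewrite tridiag_lift_image // => -[].
Qed.

(** * Symmetric matrices orthogonal to a subspace *)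

(** If [C] is invertible, an eigenvalue t of B C^-1 makes B - t C singular; it exists
    since a real polynomial of odd degree has a root. *)
Lemma singular_pencil (R : realType) (n : nat) (B C : 'M[R]_n) : odd n ->
  (forall a b, a *: B + b *: C = 0 -> a = 0 /\ b = 0) ->
  exists a b, a *: B + b *: C != 0 /\ \det (a *: B + b *: C) = 0.
Proof.
move=> oddn free.
have [C0|C0] := eqVneq (\det C) 0.
  exists 0, 1; rewrite scale0r scale1r add0r; split=> //; apply/eqP => CE.
  by have [] := free 0 1; rewrite ?CE ?scale0r ?scaler0 ?addr0 // => _ /eqP; rewrite oner_eq0.
have Cu : C \in unitmx by rewrite unitmxE unitfE.
have [t] : {t | root (char_poly (B *m invmx C)) t}.
  by apply: odd_poly_root; rewrite size_char_poly /= oddn.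
rewrite -eigenvalue_root_char => /eigenvalueP[v vE v0].
exists 1, (- t); split.
  by apply/eqP => /free[/eqP]; rewrite oner_eq0.
apply/eqP/det0P; exists v => //.
rewrite scale1r mulmxDr -scalemxAr -{1}(mulmxKV Cu B) mulmxA vE.
by rewrite -scalemxAl scaleNr subrr.
Qed.

(** Complete [v] to a basis: the row of Q A Q^T at this basis vector vanishes. *)
Lemma kernel_zero_entry (R : realType) (v : 'cV[R]_3) : v != 0 ->
  exists2 Q, Q \in unitmx &
    forall A, A^T = A -> A *m v = 0 -> (Q *m A *m Q^T) 0 2%:R = 0.
Proof.
move=> v0; pose Q := row_ebase v^T.
have [k kE] : exists k, row 0 Q = k *: v^T.
  exists (col_ebase v^T 0 0)^-1; rewrite -{2}(mulmx_ebase v^T).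
  have -> : \rank v^T = 1%N by rewrite rank_rV -trmx0 (inj_eq trmx_inj) v0.
  rewrite {2}[col_ebase _]mx11_scalar mul_scalar_mx -scalemxAl scalerA mulVf.
    rewrite scale1r; apply/rowP => i; rewrite !mxE sum_ord3 !mxE /=.
    by rewrite mul1r !mul0r !addr0.
  by have := col_ebase_unit v^T; rewrite unitmxE det_mx11 unitfE.
exists Q; first exact: row_ebase_unit.
move=> A As Av; have : row 0 (Q *m A *m Q^T) = 0.
  rewrite !row_mul kE -scalemxAl -[v^T *m A]trmxK trmx_mul trmxK As Av.
  by rewrite trmx0 scaler0 mul0mx.
by move=> /rowP/(_ 2%:R); rewrite [LHS]mxE [RHS]mxE.
Qed.

(** The index i + j + [0 < i and 0 < j] enumerates the unordered pairs of indices
    below 3: 00, 01, 02, 11, 12, 22. *)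
Definition sym_of_row (R : realType) (r : 'rV[R]_6) : 'M[R]_3 :=
  mx3 (fun i j => r 0 (inord (i + j + ((0 < i) && (0 < j)))%N)).

Lemma sym_of_row_is_linear (R : realType) : linear (@sym_of_row R).
Proof. by move=> k x y; apply/matrixP => i j; rewrite !mxE. Qed.

HB.instance Definition _ (R : realType) :=
  GRing.isLinear.Build R _ _ _ (@sym_of_row R) (@sym_of_row_is_linear R).

Lemma dim_sym3 (R : realType) : \dim (fullv : {vspace 'Sym[R]_3}) = 6%N.
Proof.
rewrite dimvf /dim /=.
have -> : symv R 3 = limg (linfun (@sym_of_row R)).
  apply/vspaceP => A; apply/symvP/memv_imgP => [As|[r _ ->]].
    exists (\row_i nth 0 [:: A 0 0; A 0 1; A 0 2%:R; A 1 1; A 1 2%:R; A 2%:R 2%:R] i).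
      exact: memvf.
    have sym i j : A i j = A j i by rewrite -{1}As mxE.
    rewrite lfunE; apply/matrixP.
    by do 2 (apply: forall_ord3 => /=); rewrite !mxE ?inordK //= ?sym.
  by rewrite lfunE; apply/matrixP => i j; rewrite !mxE (addnC i) andbC.
rewrite limg_dim_eq ?dimvf //= ?/dim /= ?mul1n //.
apply/eqP; rewrite capfv -subv0; apply/subvP => r; rewrite memv_ker lfunE memv0 /=.
move=> /eqP/matrixP r0; apply/eqP/rowP => -[[|[|[|[|[|[|//]]]]]] Hi]; rewrite mxE.
- by have := r0 0 0; rewrite !mxE /= => <-; congr (r _ _); apply: val_inj;
  rewrite /= inordK.
- by have := r0 0 1; rewrite !mxE /= => <-; congr (r _ _); apply: val_inj;
  rewrite /= inordK.
- by have := r0 0 2%:R; rewrite !mxE /= => <-; congr (r _ _); apply: val_inj;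
  rewrite /= inordK.
- by have := r0 1 1; rewrite !mxE /= => <-; congr (r _ _); apply: val_inj;
  rewrite /= inordK.
- by have := r0 1 2%:R; rewrite !mxE /= => <-; congr (r _ _); apply: val_inj;
  rewrite /= inordK.
- by have := r0 2%:R 2%:R; rewrite !mxE /= => <-; congr (r _ _); apply: val_inj;
  rewrite /= inordK.
Qed.

Lemma vsval_neq0 (R : realType) (k : nat) (B : 'Sym[R]_k) :
  B != 0 -> vsval B != 0.
Proof.
apply: contraNneq => B0; apply/eqP/val_inj.
exact: etrans B0 (esym (linear0 vsval)).
Qed.

Section TraceForm.
Variables (R : realType) (k : nat).

Definition trace_form (B A : 'Sym[R]_k) : R^o := \tr (vsval A *m vsval B).

Lemma trace_formC A B : trace_form A B = trace_form B A.
Proof. exact: mxtrace_mulC. Qed.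

Lemma trace_form_is_linear B : linear (trace_form B).
Proof.
by move=> a x y; rewrite /trace_form !linearP /= mulmxDl -scalemxAl !linearP.
Qed.

HB.instance Definition _ B :=
  GRing.isLinear.Build R _ _ _ (trace_form B) (trace_form_is_linear B).

Lemma trace_form_eq0 A : trace_form A A = 0 -> A = 0.
Proof.
have /symvP As := subvsP A.
rewrite /trace_form -{2}As /mxtrace => /eqP.
have sq i : (vsval A *m (vsval A)^T) i i = \sum_j vsval A i j ^+ 2.
  by rewrite mxE; apply: eq_bigr => j _; rewrite mxE expr2.
rewrite psumr_eq0 => [/allP A0|i _]; last by rewrite sq sumr_ge0 // => j; rewrite sqr_ge0.
apply: val_inj; apply/matrixP => i j; rewrite mxE.
have := A0 i (mem_index_enum _); rewrite sq psumr_eq0 => [|? _]; last exact: sqr_ge0.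
by move=> /allP/(_ j (mem_index_enum _)); rewrite sqrf_eq0 => /eqP.
Qed.

Section Annihilator.
Variable L : {vspace 'Sym[R]_k}.

Definition basis_pairing (B : 'Sym[R]_k) : 'rV[R]_(\dim L) :=
  \row_i trace_form B (vbasis L)`_i.

Lemma basis_pairing_is_linear : linear basis_pairing.
Proof.
move=> a x y; apply/rowP => i.
by rewrite !mxE !(trace_formC _ (vbasis L)`_i) linearP.
Qed.

HB.instance Definition _ :=
  GRing.isLinear.Build R _ _ _ basis_pairing basis_pairing_is_linear.

Definition annihilator : {vspace 'Sym[R]_k} := lker (linfun basis_pairing).

Lemma annihilatorP A B : B \in annihilator -> A \in L -> trace_form B A = 0.
Proof.
rewrite memv_ker lfunE => /eqP/rowP B0 /coord_vbasis ->.
rewrite linear_sum big1 //= => i _; rewrite linearZ /=.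
by have := B0 i; rewrite !mxE => ->; rewrite scaler0.
Qed.

(** The annihilator is the kernel of the pairing with a basis of [L]. *)
Lemma dim_annihilator :
  (\dim (fullv : {vspace 'Sym[R]_k}) <= \dim annihilator + \dim L)%N.
Proof.
rewrite -(limg_ker_dim (linfun basis_pairing) fullv) capfv leq_add2l.
by rewrite (leq_trans (dimvS (subvf _))) // dimvf /dim /= mul1n.
Qed.

End Annihilator.
End TraceForm.

Lemma exists_annihilating (R : realType) (L : {vspace 'Sym[R]_3}) :
  (\dim L <= 5)%N -> exists2 B, B != 0 & forall A, A \in L -> trace_form B A = 0.
Proof.
move=> dL; have := dim_annihilator L; rewrite dim_sym3 => d6.
have ann0 : annihilator L != 0%VS.
  by rewrite -dimv_eq0; apply/eqP => d0; rewrite d0 in d6; lia.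
exists (vpick (annihilator L)); first by rewrite vpick0.
by move=> A; apply: annihilatorP; apply: memv_pick.
Qed.

(** The annihilator has dimension at least 6 - 4 = 2, so it contains a pencil, and
    every pencil of matrices of odd size has a singular member. *)
Lemma exists_singular_annihilating (R : realType) (L : {vspace 'Sym[R]_3}) :
  (\dim L <= 4)%N -> exists B, [/\ B != 0, \det (vsval B) = 0 &
    forall A, A \in L -> trace_form B A = 0].
Proof.
move=> dL; have := dim_annihilator L; rewrite dim_sym3 => d6.
have d2 : (1 < \dim (annihilator L))%N by lia.
have /freeP free := basis_free (vbasisP (annihilator L)).
pose i0 := Ordinal (ltnW d2); pose i1 := Ordinal d2.
pose B := (vbasis (annihilator L))`_i0; pose C := (vbasis (annihilator L))`_i1.
have Bann : B \in annihilator L by apply: vbasis_mem; rewrite mem_nth ?size_tuple.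
have Cann : C \in annihilator L by apply: vbasis_mem; rewrite mem_nth ?size_tuple.
have [a [b [D0 detD]]] : exists a b, a *: vsval B + b *: vsval C != 0 /\
    \det (a *: vsval B + b *: vsval C) = 0.
  apply: singular_pencil => // a b abE.
  have abE' : a *: B + b *: C = 0 by apply: val_inj; rewrite linearP linearZ.
  pose c i := if i == i0 then a else if i == i1 then b else 0.
  have c0 : forall i, c i = 0.
    apply: free; rewrite (bigD1 i0) //= (bigD1 i1) //= big1 => [|i /andP[ii0 ii1]].
      by rewrite addr0 /c !eqxx.
    by rewrite /c (negPf ii0) (negPf ii1) scale0r.
  by have := c0 i0; have := c0 i1; rewrite /c !eqxx.
exists (a *: B + b *: C); split=> [||A AL].
- by apply: contraNneq D0 => /(congr1 vsval); rewrite linearP linearZ linear0 => ->.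
- by rewrite linearP linearZ.
- by apply: annihilatorP AL; rewrite memvD ?memvZ.
Qed.

(** [L] and the orthogonal of [B] both have dimension 5, since tr(B B) > 0. *)
Lemma hyperplane_orthogonal (R : realType) (L : {vspace 'Sym[R]_3}) B A :
  \dim L = 5%N -> B != 0 -> (forall A, A \in L -> trace_form B A = 0) ->
  trace_form B A = 0 -> A \in L.
Proof.
move=> dL B0 LB BA; pose H := lker (linfun (trace_form B)).
have memH D : (D \in H) = (trace_form B D == 0) by rewrite memv_ker lfunE.
suff -> : L = H by rewrite memH BA.
apply/eqP; rewrite eqEdim dL; apply/andP; split.
  by apply/subvP => D /LB DB; rewrite memH DB.
rewrite -ltnS -(dim_sym3 R) ltn_neqAle dimvS ?subvf // andbT.
apply/eqP => dH; have : B \in H.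
  have /eqP -> : H == fullv by rewrite eqEdim subvf dH leqnn.
  exact: memvf.
by rewrite memH => /eqP/trace_form_eq0/eqP; rewrite (negPf B0).
Qed.

Definition eval_vec (R : realType) (k : nat) (v : 'cV[R]_k) (A : 'Sym[R]_k) :
  'cV[R]_k := vsval A *m v.

Lemma eval_vec_is_linear (R : realType) (k : nat) (v : 'cV[R]_k) :
  linear (eval_vec v).
Proof. by move=> a A B; rewrite /eval_vec [vsval _]linearP /= mulmxDl -scalemxAl. Qed.

HB.instance Definition _ (R : realType) (k : nat) (v : 'cV[R]_k) :=
  GRing.isLinear.Build R _ _ _ (eval_vec v) (eval_vec_is_linear v).

(** The map A |-> A v is onto, so its kernel has codimension 3 and contains no
    hyperplane. Concretely, for nonzero z orthogonal to v, the matrices v v^T and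
    (v + z) (v + z)^T map v to independent vectors, while some nonzero combination of
    them is orthogonal to [B]. *)
Lemma kernel_codim (R : realType) (B : 'Sym[R]_3) (v : 'cV[R]_3) :
  v != 0 ->
  ~ (forall A : 'Sym[R]_3, trace_form B A = 0 -> vsval A *m v = 0).
Proof.
move=> v0 kerB.
pose q (w : 'cV[R]_3) := vsproj (symv R 3) (w *m w^T).
have qE w : vsval (q w) = w *m w^T.
  by rewrite vsprojK //; apply/symvP; rewrite trmx_mul trmxK.
have dotvv : bil 1%:M v v != 0.
  apply: contraNneq v0; rewrite bil3 !mxE /= => vv.
  by apply/eqP/colP; apply: forall_ord3; rewrite mxE; nra.
have [z zv zz] : exists2 z, bil 1%:M z v = 0 & bil 1%:M z z != 0.
  have [v00|v00] := eqVneq (v 0 0) 0.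
    exists (\col_i nth 0 [:: 1; 0; 0] i); rewrite bil3 !mxE /= ?v00.
      by ring.
    by rewrite !(mul0r, mulr0, mul1r, addr0) oner_neq0.
  exists (\col_i nth 0 [:: - v 1 0; v 0 0; 0] i); rewrite bil3 !mxE /=.
    by ring.
  apply: contraNneq v00 => zz; apply/eqP; nra.
set a := trace_form B (q v); set b := trace_form B (q (v + z)).
have a0 : a = 0.
  have /kerB : trace_form B (b *: q v - a *: q (v + z)) = 0.
    rewrite linearB !linearZ /= -/a -/b scalerN.
    by apply/eqP; rewrite subr_eq0; apply/eqP; exact: (mulrC b a).
  rewrite [vsval _]linearB [X in (X - _) *m _]linearZ [X in (_ - X) *m _]linearZ /=.
  rewrite !qE mulmxBl -!scalemxAl !mulmx_rank1 bilDl zv addr0.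
  move=> /(congr1 (bil 1%:M z)); rewrite -scaleN1r bilDr !bilZr bilDr zv.
  rewrite /(bil _ z 0) mulmx0 mxE => azz.
  have /eqP : a * bil 1%:M v v * bil 1%:M z z = 0 by lra.
  by rewrite !mulf_eq0 (negPf dotvv) (negPf zz) !orbF => /eqP.
have := kerB (q v) a0; rewrite qE mulmx_rank1 => /eqP.
by rewrite scaler_eq0 (negPf v0) (negPf dotvv).
Qed.

(** * Conics and slices without lift *)

(** A rational parametrization of the conic 2 x_0 x_2 + c x_1^2 = 0. *)
Definition conic_pt (R : realType) (c : R) (n : nat) : 'cV[R]_3 :=
  \col_i nth 0 [:: 1; n%:R; - (c / 2%:R) * n%:R ^+ 2] i.

Lemma conic_pt_isotropic (R : realType) (c : R) n :
  bil (hyperbolic_mx c) (conic_pt c n) (conic_pt c n) = 0.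
Proof. by rewrite bil3 !mxE /=; field. Qed.

(** The determinant of three points of the conic is of Vandermonde type, so no three
    of them are collinear when [c] is nonzero. *)
Lemma cross_conic_pt (R : realType) (c : R) (s t u : nat) :
  bil 1%:M (cross (conic_pt c s) (conic_pt c t)) (conic_pt c u) =
  (c / 2%:R) * (s%:R - t%:R) * (u%:R - s%:R) * (u%:R - t%:R).
Proof. by rewrite bil3 !mxE /=; field. Qed.

Definition eval_form (R : realType) (k : nat) (w : 'cV[R]_k) (A : 'Sym[R]_k) : R^o :=
  bil (vsval A) w w.

Lemma eval_form_is_linear (R : realType) (k : nat) (w : 'cV[R]_k) :
  linear (eval_form w).
Proof.
move=> a A B; rewrite /eval_form /bil [vsval _]linearP /= mulmxDr mulmxDl -scalemxAr.
by rewrite -scalemxAl !mxE.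
Qed.

HB.instance Definition _ (R : realType) (k : nat) (w : 'cV[R]_k) :=
  GRing.isLinear.Build R _ _ _ (eval_form w) (eval_form_is_linear w).

Lemma bil_rank1 (R : realType) (n : nat) (v w : 'cV[R]_n) :
  bil (v *m v^T) w w = bil 1%:M w v ^+ 2.
Proof.
rewrite expr2 {2}(bilC w v) ?trmx1 // /bil !mulmx1.
by rewrite mulmxA -mulmxA mxE big_ord1.
Qed.

Lemma bil_mull (R : realType) (n : nat) (M : 'M[R]_n) (x y : 'cV[R]_n) :
  bil 1%:M (M *m x) y = bil 1%:M x (M^T *m y).
Proof. by rewrite /bil !mulmx1 trmx_mul mulmxA. Qed.

(** The matrices v v^T, for v on the conic, form a neighborly family: the form
    given by the cross product of two points vanishes at no third one. *)
Lemma nondegenerate_not_socr (R : realType) (Q : 'M[R]_3) (c : R)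
    (S : set 'Sym[R]_3) :
  Q \in unitmx -> c != 0 ->
  (forall A, S A <-> psd_cone R 3 A /\
     \tr (vsval A *m (Q^T *m hyperbolic_mx c *m Q)) = 0) ->
  ~ socr S.
Proof.
move=> Qu c0 SP [m _]; pose v n := invmx Q *m conic_pt c n.
have vsym n : v n *m (v n)^T \in symv R 3.
  by apply/symvP; rewrite trmx_mul trmxK.
pose h n := vsproj (symv R 3) (v n *m (v n)^T).
have hE n : vsval (h n) = v n *m (v n)^T by rewrite vsprojK.
pose f s t : {linear 'Sym[R]_3 -> R^o} :=
  eval_form (Q^T *m cross (conic_pt c s) (conic_pt c t)).
have fh s t u : f s t (h u) =
    ((c / 2%:R) * (s%:R - t%:R) * (u%:R - s%:R) * (u%:R - t%:R)) ^+ 2.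
  rewrite /f /= /eval_form hE bil_rank1 bil_mull trmxK /v mulmxA mulmxV //.
  by rewrite mul1mx cross_conic_pt.
apply: (@no_lorentz_lift _ _ _ _ h f) => [n|s t A /SP[/psd_coneP[_ A0] _]|s t|s t|s t u st us ut].
- apply/SP; split.
    by move=> x; rewrite hE -/(bil _ x x) bil_rank1 sqr_ge0.
  rewrite hE mxtrace_mulC mxtrace_rank1 /bil /v trmx_mul !mulmxA.
  rewrite -[_ *m Q^T]mulmxA -trmx_mul mulmxV // trmx1 mulmx1 -!mulmxA mulKVmx //.
  by rewrite mulmxA; exact: conic_pt_isotropic.
- exact: A0.
- by rewrite fh subrr mulr0 mul0r expr0n.
- by rewrite fh subrr mulr0 expr0n.
- rewrite fh sqrf_eq0 !mulf_neq0 ?invr_neq0 ?pnatr_eq0 // subr_eq0 eqr_nat; exact/eqP.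
Qed.

(** * Slices of dimension at most five *)

Lemma small_slice_lift (R : realType) (S : set 'Sym[R]_3) :
  slice (psd_cone R 3) S -> (set_dim S <= 4)%N -> has_lift (lorentz_pow R 2) S.
Proof.
move=> sS dS; have [B [B0 detB SB]] := exists_singular_annihilating dS.
have trB A : S A -> psd (vsval A) /\ \tr (vsval A *m vsval B) = 0.
  move=> SA; split; first by apply/psd_coneP; case: sS SA => L -> [].
  by apply: SB; apply: (linear_hullP S).1.
have /symvP Bs := subvsP B.
have B0' := vsval_neq0 B0.
have [[v v0 vP]|[Q Qu [c BE]]] := symmetric_form_dichotomy Bs B0'.
  have [Q Qu QP] := kernel_zero_entry v0.
  apply: (slice_tridiag_lift Qu sS) => A /trB[pA tA].
  by apply: QP; [case: pA|apply: vP].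
apply: (slice_tridiag_lift Qu sS) => A /trB[[As _]].
have c0 : c = 0.
  move: detB; rewrite BE !det_mulmx det_tr hyperbolic_det => /eqP.
  move: Qu; rewrite unitmxE unitfE => /negPf Qu.
  by rewrite !mulf_eq0 Qu /= orbF oppr_eq0 => /eqP.
rewrite BE mxtrace_hyperbolic // c0 mul0r addr0 => /eqP.
by rewrite mulf_eq0 pnatr_eq0 => /eqP.
Qed.

Lemma socr_hyperplane_image (R : realType) (S : set 'Sym[R]_3) :
  slice (psd_cone R 3) S -> set_dim S = 5%N -> socr S ->
  exists f : {linear {ffun 'I_2 -> 'rV[R]_3} -> 'Sym[R]_3},
    S = f @` lorentz_pow R 2.
Proof.
move=> [L SE] dS Ssocr.
have [B B0 SB] := exists_annihilating (eq_leq dS).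
have inL A : A \in linear_hull S -> A \in L.
  apply: subvP; apply: (linear_hullP S).2 => D; by rewrite SE => -[].
have SP A : S A <-> psd_cone R 3 A /\ trace_form B A = 0.
  split=> [SA|[pA BA]].
    by split; [move: SA; rewrite SE => -[]|apply: SB; apply: (linear_hullP S).1].
  by rewrite SE; split=> //=; apply: inL; apply: (hyperplane_orthogonal dS B0 SB).
have /symvP Bs := subvsP B.
have B0' := vsval_neq0 B0.
have [[v v0 vP]|[Q Qu [c BE]]] := symmetric_form_dichotomy Bs B0'.
  case: (kernel_codim (B := B) v0) => A BA.
  pose K := lker (linfun (eval_vec v)).
  have KP D : (D \in K) = (vsval D *m v == 0) by rewrite memv_ker lfunE.
  apply/eqP; rewrite -KP; apply: subvP (hyperplane_orthogonal dS B0 SB BA).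
  apply: (linear_hullP S).2 => D /SP[/psd_coneP pD BD].
  by rewrite KP; apply/eqP/vP.
have SP' A : S A <-> psd_cone R 3 A /\
    2%:R * (Q *m vsval A *m Q^T) 0 2%:R + c * (Q *m vsval A *m Q^T) 1 1 = 0.
  have /symvP As := subvsP A.
  by rewrite SP /trace_form BE mxtrace_hyperbolic.
have [c0|c0] := eqVneq c 0; last first.
  case: (nondegenerate_not_socr Qu c0 _ Ssocr) => A.
  by rewrite SP /trace_form BE.
exists (tridiag_lift Q); rewrite tridiag_lift_image //; apply/seteqP.
split=> A /=; rewrite SP' c0 mul0r addr0 => -[pA /eqP tA]; split=> //; move: tA.
  by rewrite mulf_eq0 pnatr_eq0 => /eqP.
by move=> /eqP->; rewrite mulr0.
Qed.

Theorem corollary2 (R : realType) :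
  (forall S : set 'Sym[R]_3,
      slice (psd_cone R 3) S -> (set_dim S <= 4)%N ->
      has_lift (lorentz_pow R 2) S) /\
  (forall S : set 'Sym[R]_3,
      slice (psd_cone R 3) S -> set_dim S = 5%N -> socr S ->
      exists f : {linear {ffun 'I_2 -> 'rV[R]_3} -> 'Sym[R]_3},
        S = f @` lorentz_pow R 2).
Proof.
split; first exact: small_slice_lift.
exact: socr_hyperplane_image.
Qed.
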